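(* Let $\mathbf H=(\underline H,\overline H,\omega)$ be a compatible weak (monad-comonad) entwining on a category $\mathbb A$, for which the idempotent $\Gamma$ splits, so that the induced comonad $\mathbf G$ on $\mathbb A_{\underline H}$ is defined. Then the functor $K:\mathbb A\to(\mathbb A_{\underline H})^{\mathbf G}$ (and hence also $K_\omega:\mathbb A\to\mathbb A^{\overline H}_{\underline H}(\omega)$) has a right adjoint if and only if, for any $(a,h,\theta)\in\mathbb A^{\overline H}_{\underline H}(\omega)$, the pair of morphisms $$\theta,\quad H(h)\cdot\delta_a\cdot e_a\;:\;a\rightrightarrows H(a)$$ has an equaliser in $\mathbb A$.
   Context: $\cdot$ is vertical composition of natural transformations and juxtaposition is composition of functors and whiskering. $\mathbb A_{\underline H}$, $\mathbb A^{\overline H}$ are the Eilenberg–Moore categories of modules of the monad $\underline H$ and comodules of the comonad $\overline H$; $(\mathbb A_{\underline H})^{\mathbf G}$ is the category of $\mathbf G$-comodules in $\mathbb A_{\underline H}$. Weak entwining. Let $\underline H=(H,m,e)$ be a monad and $\overline H=(H,\delta,\varepsilon)$ a comonad on $\mathbb A$ with the same endofunctor $H$. For $\omega:HH\to HH$ put $\xi:=\varepsilon H\cdot\omega\cdot eH:H\to H$. $(\underline H,\overline H,\omega)$ is a weak entwining if (i) $\omega\cdot mH=Hm\cdot\omega H\cdot H\omega$ and $\delta H\cdot\omega=H\omega\cdot\omega H\cdot H\delta$; (ii) $\omega\cdot eH=H\xi\cdot\delta$ and $\varepsilon H\cdot\omega=m\cdot H\xi$. It is compatible if $\delta\cdot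 m=Hm\cdot\omega H\cdot H\delta$. Mixed bimodules. $\mathbb A^{\overline H}_{\underline H}(\omega)$ has as objects triples $(a,h,\theta)$ with $(a,h)\in\mathbb A_{\underline H}$, $(a,\theta)\in\mathbb A^{\overline H}$ and $\theta\cdot h=H(h)\cdot\omega_a\cdot H(\theta)$; morphisms are morphisms of $\mathbb A$ that are both $\underline H$-module and $\overline H$-comodule morphisms. By compatibility there is a functor $K_\omega:\mathbb A\to\mathbb A^{\overline H}_{\underline H}(\omega)$, $a\mapsto(H(a),m_a,\delta_a)$. Induced comonad $\mathbf G$. For $(a,h)\in\mathbb A_{\underline H}$ the morphism $\Gamma_{(a,h)}:=H(h)\cdot\omega_a\cdot e_{H(a)}:H(a)\to H(a)$ is a natural idempotent; let $\Gamma=i\cdot p$, $p\cdot i=1$, with $p_{(a,h)}:H(a)\to G(a,h)$, $i_{(a,h)}:G(a,h)\to H(a)$, be its splitting. The functor part of $\mathbf G$ sends $(a,h)$ to $G(a,h)$ with module structure $p_{(a,h)}\cdot H(h)\cdot\omega_a\cdot H(i_{(a,h)})$; its comultiplication is $p_{G(a,h)}\cdot H(p_{(a,h)})\cdot\delta_a\cdot i_{(a,h)}:G(a,h)\to GG(a,h)$ and its counit is $h\cdot i_{(a,h)}:G(a,h)\to a$. There is an isomorphism of categories $\Phi:\mathbb A^{\overline H}_{\underline H}(\omega)\to(\mathbb A_{\underline H})^{\mathbf G}$, $(a,h,\theta)\mapsto((a,h),p_{(a,h)}\cdot\theta)$, and $K:=\Phi K_\omega$, i.e. $K(a)=((H(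a),m_a),\,p_{(H(a),m_a)}\cdot\delta_a)$.
   Formalization: The counit of the induced comonad G is taken to be ε_a·i_{(a,h)} instead of the printed h·i_{(a,h)}, with which G is in general not a comonad (e.g. for the entwining of the bialgebra k[Z/2]). *)

(* Defs.v *)
From Stdlib Require Import ssreflect ProofIrrelevance.

Set Implicit Arguments.
Unset Strict Implicit.
Unset Printing Implicit Defensive.

Declare Scope cat_scope.
Delimit Scope cat_scope with cat.
Local Open Scope cat_scope.

(** * Categories, functors, natural transformations *)

Record category := Category {
  ob :> Type;
  hom : ob -> ob -> Type;
  idm : forall a, hom a a;
  comp : forall a b c, hom b c -> hom a b -> hom a c;
  comp_idl : forall a b (f : hom a b), comp (idm b) f = f;
  comp_idr : forall a b (f : hom a b), comp f (idm a) = f;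
  comp_assoc : forall a b c d (h : hom c d) (g : hom b c) (f : hom a b),
    comp h (comp g f) = comp (comp h g) f }.

Arguments hom {c} a b : rename.
Arguments idm {c} a : rename.
Arguments comp {c a b c0} g f : rename.
Notation "g ∘ f" := (comp g f) (at level 40, left associativity) : cat_scope.

Record functor (A B : category) := Functor {
  fobj :> A -> B;
  fmap : forall a b, hom a b -> hom (fobj a) (fobj b);
  fmap_id : forall a, fmap (idm a) = idm (fobj a);
  fmap_comp : forall a b c (g : hom b c) (f : hom a b),
    fmap (g ∘ f) = fmap g ∘ fmap f }.

Arguments fmap {A B} F {a b} f : rename.

Definition fid (A : category) : functor A A :=
  @Functor A A (fun a => a) (fun _ _ f => f)
    (fun _ => eq_refl) (fun _ _ _ _ _ => eq_refl).

Lemma fcomp_id (A B C : category) (G : functor B C) (F : functor A B) (a : A) :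
  fmap G (fmap F (idm a)) = idm (G (F a)).
Proof. by rewrite !fmap_id. Qed.

Lemma fcomp_comp (A B C : category) (G : functor B C) (F : functor A B)
    (a b c : A) (g : hom b c) (f : hom a b) :
  fmap G (fmap F (g ∘ f)) = fmap G (fmap F g) ∘ fmap G (fmap F f).
Proof. by rewrite !fmap_comp. Qed.

Definition fcomp (A B C : category) (G : functor B C) (F : functor A B) :
    functor A C :=
  @Functor A C (fun a => G (F a)) (fun a b f => fmap G (fmap F f))
    (fcomp_id G F) (fcomp_comp G F).

Record nat_trans (A B : category) (F G : functor A B) := NatTrans {
  component :> forall a, hom (F a) (G a);
  naturality : forall a b (f : hom a b),
    component b ∘ fmap F f = fmap G f ∘ component a }.

(** * Adjunctions and equalisers *)

Record adjunction (A B : category) (L : functor A B) (R : functor B A) :=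
  Adjunction {
    adj_unit : nat_trans (fid A) (fcomp R L);
    adj_counit : nat_trans (fcomp L R) (fid B);
    adj_triangle_l : forall a,
      adj_counit (L a) ∘ fmap L (adj_unit a) = idm (L a);
    adj_triangle_r : forall b,
      fmap R (adj_counit b) ∘ adj_unit (R b) = idm (R b) }.

Definition has_right_adjoint (A B : category) (L : functor A B) : Prop :=
  exists R : functor B A, inhabited (adjunction L R).

Definition is_equaliser (A : category) (a b : A) (f g : hom a b)
    (x : A) (k : hom x a) : Prop :=
  f ∘ k = g ∘ k /\
  forall (y : A) (t : hom y a), f ∘ t = g ∘ t ->
    exists! u : hom y x, k ∘ u = t.

Definition has_equaliser (A : category) (a b : A) (f g : hom a b) : Prop :=
  exists (x : A) (k : hom x a), is_equaliser f g k.

(** * Monads and their modules *)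

Record monad (A : category) (H : functor A A) := Monad {
  monad_mult : nat_trans (fcomp H H) H;
  monad_unit : nat_trans (fid A) H;
  mult_assoc : forall a,
    monad_mult a ∘ monad_mult (H a) = monad_mult a ∘ fmap H (monad_mult a);
  mult_unit_l : forall a, monad_mult a ∘ monad_unit (H a) = idm (H a);
  mult_unit_r : forall a, monad_mult a ∘ fmap H (monad_unit a) = idm (H a) }.

Record is_module (A : category) (H : functor A A) (T : monad H)
    (a : A) (h : hom (H a) a) : Prop := IsModule {
  module_assoc : h ∘ monad_mult T a = h ∘ fmap H h;
  module_unit : h ∘ monad_unit T a = idm a }.

Record module (A : category) (H : functor A A) (T : monad H) := Module {
  carrier : A;
  action : hom (H carrier) carrier;
  module_axioms : is_module T action }.

Record module_hom (A : category) (H : functor A A) (T : monad H)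
    (M N : module T) := ModuleHom {
  module_map :> hom (carrier M) (carrier N);
  module_map_action :
    module_map ∘ action M = action N ∘ fmap H module_map }.

(** * Comonads and their comodules *)

Record comonad (A : category) (H : functor A A) := Comonad {
  comonad_comult : nat_trans H (fcomp H H);
  comonad_counit : nat_trans H (fid A);
  comult_coassoc : forall a,
    comonad_comult (H a) ∘ comonad_comult a
    = fmap H (comonad_comult a) ∘ comonad_comult a;
  comult_counit_l : forall a,
    comonad_counit (H a) ∘ comonad_comult a = idm (H a);
  comult_counit_r : forall a,
    fmap H (comonad_counit a) ∘ comonad_comult a = idm (H a) }.

Record is_comodule (A : category) (H : functor A A) (D : comonad H)
    (a : A) (t : hom a (H a)) : Prop := IsComodule {
  comodule_coassoc : comonad_comult D a ∘ t = fmap H t ∘ t;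
  comodule_counit : comonad_counit D a ∘ t = idm a }.

Record comodule (A : category) (H : functor A A) (D : comonad H) := Comodule {
  cocarrier : A;
  coaction : hom cocarrier (H cocarrier);
  comodule_axioms : is_comodule D coaction }.

Record comodule_hom (A : category) (H : functor A A) (D : comonad H)
    (M N : comodule D) := ComoduleHom {
  comodule_map :> hom (cocarrier M) (cocarrier N);
  comodule_map_coaction :
    coaction N ∘ comodule_map = fmap H comodule_map ∘ coaction M }.

(** * Eilenberg-Moore categories *)

Lemma module_hom_eq (A : category) (H : functor A A) (T : monad H)
    (M N : module T) (f g : module_hom M N) :
  module_map f = module_map g -> f = g.
Proof.
case: f g => [f Hf] [g Hg] /= E; subst g.
by rewrite (proof_irrelevance _ Hf Hg).
Qed.

Lemma comodule_hom_eq (A : category) (H : functor A A) (D : comonad H)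
    (M N : comodule D) (f g : comodule_hom M N) :
  comodule_map f = comodule_map g -> f = g.
Proof.
case: f g => [f Hf] [g Hg] /= E; subst g.
by rewrite (proof_irrelevance _ Hf Hg).
Qed.

Section ModuleCategory.
Context (A : category) (H : functor A A) (T : monad H).

Lemma module_id_proof (M : module T) :
  idm (carrier M) ∘ action M = action M ∘ fmap H (idm (carrier M)).
Proof. by rewrite fmap_id comp_idl comp_idr. Qed.

Definition module_id (M : module T) : module_hom M M :=
  ModuleHom (module_id_proof M).

Lemma module_comp_proof (M N P : module T)
    (g : module_hom N P) (f : module_hom M N) :
  g ∘ f ∘ action M = action P ∘ fmap H (g ∘ f).
Proof.
by rewrite -comp_assoc module_map_action comp_assoc module_map_action
  fmap_comp comp_assoc.
Qed.

Definition module_comp (M N P : module T)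
    (g : module_hom N P) (f : module_hom M N) : module_hom M P :=
  ModuleHom (module_comp_proof g f).

Definition module_category : category.
Proof.
refine (@Category (module T) (@module_hom A H T) module_id module_comp _ _ _).
- by move=> a b f; apply: module_hom_eq; apply: comp_idl.
- by move=> a b f; apply: module_hom_eq; apply: comp_idr.
- by move=> a b c d h g f; apply: module_hom_eq; apply: comp_assoc.
Defined.

End ModuleCategory.

Section ComoduleCategory.
Context (A : category) (H : functor A A) (D : comonad H).

Lemma comodule_id_proof (M : comodule D) :
  coaction M ∘ idm (cocarrier M) = fmap H (idm (cocarrier M)) ∘ coaction M.
Proof. by rewrite fmap_id comp_idl comp_idr. Qed.

Definition comodule_id (M : comodule D) : comodule_hom M M :=
  ComoduleHom (comodule_id_proof M).

Lemma comodule_comp_proof (M N P : comodule D)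
    (g : comodule_hom N P) (f : comodule_hom M N) :
  coaction P ∘ (g ∘ f) = fmap H (g ∘ f) ∘ coaction M.
Proof.
by rewrite comp_assoc comodule_map_coaction -comp_assoc comodule_map_coaction
  fmap_comp comp_assoc.
Qed.

Definition comodule_comp (M N P : comodule D)
    (g : comodule_hom N P) (f : comodule_hom M N) : comodule_hom M P :=
  ComoduleHom (comodule_comp_proof g f).

Definition comodule_category : category.
Proof.
refine (@Category (comodule D) (@comodule_hom A H D)
  comodule_id comodule_comp _ _ _).
- by move=> a b f; apply: comodule_hom_eq; apply: comp_idl.
- by move=> a b f; apply: comodule_hom_eq; apply: comp_idr.
- by move=> a b c d h g f; apply: comodule_hom_eq; apply: comp_assoc.
Defined.

End ComoduleCategory.

(** * Weak entwinings *)

Definition xi (A : category) (H : functor A A) (T : monad H) (D : comonad H)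
    (w : nat_trans (fcomp H H) (fcomp H H)) (a : A) : hom (H a) (H a) :=
  comonad_counit D (H a) ∘ w a ∘ monad_unit T (H a).

Record weak_entwining (A : category) (H : functor A A) (T : monad H)
    (D : comonad H) (w : nat_trans (fcomp H H) (fcomp H H)) : Prop :=
  WeakEntwining {
    entwining_mult : forall a,
      w a ∘ monad_mult T (H a) = fmap H (monad_mult T a) ∘ w (H a) ∘ fmap H (w a);
    entwining_comult : forall a,
      comonad_comult D (H a) ∘ w a = fmap H (w a) ∘ w (H a) ∘ fmap H (comonad_comult D a);
    entwining_unit : forall a,
      w a ∘ monad_unit T (H a) = fmap H (xi T D w a) ∘ comonad_comult D a;
    entwining_counit : forall a,
      comonad_counit D (H a) ∘ w a = monad_mult T a ∘ fmap H (xi T D w a) }.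

Definition compatible (A : category) (H : functor A A) (T : monad H)
    (D : comonad H) (w : nat_trans (fcomp H H) (fcomp H H)) : Prop :=
  forall a, comonad_comult D a ∘ monad_mult T a
            = fmap H (monad_mult T a) ∘ w (H a) ∘ fmap H (comonad_comult D a).

(** * Mixed bimodules *)

Record bimodule (A : category) (H : functor A A) (T : monad H) (D : comonad H)
    (w : nat_trans (fcomp H H) (fcomp H H)) := Bimodule {
  bicarrier : A;
  biaction : hom (H bicarrier) bicarrier;
  bicoaction : hom bicarrier (H bicarrier);
  bimodule_module : is_module T biaction;
  bimodule_comodule : is_comodule D bicoaction;
  bimodule_mixed :
    bicoaction ∘ biaction = fmap H biaction ∘ w bicarrier ∘ fmap H bicoaction }.

Record bimodule_hom (A : category) (H : functor A A) (T : monad H)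
    (D : comonad H) (w : nat_trans (fcomp H H) (fcomp H H))
    (M N : bimodule T D w) := BimoduleHom {
  bimodule_map :> hom (bicarrier M) (bicarrier N);
  bimodule_map_action :
    bimodule_map ∘ biaction M = biaction N ∘ fmap H bimodule_map;
  bimodule_map_coaction :
    bicoaction N ∘ bimodule_map = fmap H bimodule_map ∘ bicoaction M }.

Lemma bimodule_hom_eq (A : category) (H : functor A A) (T : monad H)
    (D : comonad H) (w : nat_trans (fcomp H H) (fcomp H H))
    (M N : bimodule T D w) (f g : bimodule_hom M N) :
  bimodule_map f = bimodule_map g -> f = g.
Proof.
case: f g => [f Hf Kf] [g Hg Kg] /= E; subst g.
by rewrite (proof_irrelevance _ Hf Hg) (proof_irrelevance _ Kf Kg).
Qed.

Section BimoduleCategory.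
Context (A : category) (H : functor A A) (T : monad H) (D : comonad H).
Context (w : nat_trans (fcomp H H) (fcomp H H)).

Definition bimodule_id (M : bimodule T D w) : bimodule_hom M M.
Proof.
exists (idm (bicarrier M)).
- by rewrite fmap_id comp_idl comp_idr.
- by rewrite fmap_id comp_idl comp_idr.
Defined.

Definition bimodule_comp (M N P : bimodule T D w)
    (g : bimodule_hom N P) (f : bimodule_hom M N) : bimodule_hom M P.
Proof.
exists (g ∘ f).
- by rewrite -comp_assoc bimodule_map_action comp_assoc bimodule_map_action
    fmap_comp comp_assoc.
- by rewrite comp_assoc bimodule_map_coaction -comp_assoc
    bimodule_map_coaction fmap_comp comp_assoc.
Defined.

Definition bimodule_category : category.
Proof.
refine (@Category (bimodule T D w) (@bimodule_hom A H T D w)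
  bimodule_id bimodule_comp _ _ _).
- by move=> a b f; apply: bimodule_hom_eq; apply: comp_idl.
- by move=> a b f; apply: bimodule_hom_eq; apply: comp_idr.
- by move=> a b c d h g f; apply: bimodule_hom_eq; apply: comp_assoc.
Defined.

Definition bimodule_to_module (M : bimodule T D w) : module T :=
  Module (bimodule_module M).

End BimoduleCategory.

(** * The comparison functor into mixed bimodules *)

Section ComparisonBimodules.
Context (A : category) (H : functor A A) (T : monad H) (D : comonad H).
Context (w : nat_trans (fcomp H H) (fcomp H H)) (HC : compatible T D w).

Lemma free_is_module (a : A) : is_module T (monad_mult T a).
Proof. by split; [apply: mult_assoc | apply: mult_unit_l]. Qed.

Lemma cofree_is_comodule (a : A) : is_comodule D (comonad_comult D a).
Proof. by split; [apply: comult_coassoc | apply: comult_counit_l]. Qed.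

Definition free_bimodule (a : A) : bimodule T D w :=
  Bimodule (free_is_module a) (cofree_is_comodule a) (HC a).

Definition free_bimodule_map (a b : A) (f : hom a b) :
    bimodule_hom (free_bimodule a) (free_bimodule b) :=
  @BimoduleHom A H T D w (free_bimodule a) (free_bimodule b) (fmap H f)
    (eq_sym (naturality (monad_mult T) f)) (naturality (comonad_comult D) f).

Definition K_omega : functor A (bimodule_category T D w).
Proof.
refine (@Functor A (bimodule_category T D w)
  free_bimodule free_bimodule_map _ _).
- by move=> a; apply: bimodule_hom_eq; apply: fmap_id.
- by move=> a b c g f; apply: bimodule_hom_eq; apply: fmap_comp.
Defined.

End ComparisonBimodules.

(** * The idempotent Γ and its splittings *)

Definition Gamma (A : category) (H : functor A A) (T : monad H)
    (w : nat_trans (fcomp H H) (fcomp H H)) (M : module T) :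
    hom (H (carrier M)) (H (carrier M)) :=
  fmap H (action M) ∘ w (carrier M) ∘ monad_unit T (H (carrier M)).

(* A splitting of the natural transformation Γ amounts to a splitting of each
   component: the functoriality of [split_ob] and the naturality of [split_p]
   and [split_i] are then forced, see [G_functor] below. *)
Record Gamma_splitting (A : category) (H : functor A A) (T : monad H)
    (w : nat_trans (fcomp H H) (fcomp H H)) := GammaSplitting {
  split_ob : module T -> A;
  split_p : forall M : module T, hom (H (carrier M)) (split_ob M);
  split_i : forall M : module T, hom (split_ob M) (H (carrier M));
  split_ip : forall M, split_i M ∘ split_p M = Gamma w M;
  split_pi : forall M, split_p M ∘ split_i M = idm (split_ob M) }.

(** * The induced comonad on modules *)

Lemma post2 (A : category) (a b c : A) (g : hom b c) (f : hom a b) k :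
  g ∘ f = k -> forall (x : A) (t : hom c x), t ∘ g ∘ f = t ∘ k.
Proof. by move=> <- x t; rewrite comp_assoc. Qed.

(* Left-nests all composites without unfolding any of the factors. *)
Ltac assocl :=
  repeat match goal with
  | |- context [@comp _ _ _ _ ?h (@comp _ _ _ _ ?g ?f)] =>
      rewrite (@comp_assoc _ _ _ _ _ h g f)
  end.

(* Likewise distributes functors over composites, then left-nests. *)
Ltac fmapl :=
  repeat match goal with
  | |- context [@fmap _ _ ?F _ _ (@comp _ _ _ _ ?g ?f)] =>
      rewrite (@fmap_comp _ _ F _ _ _ g f)
  end; assocl.

Section InducedComonad.
Context (A : category) (H : functor A A) (T : monad H) (D : comonad H).
Context (w : nat_trans (fcomp H H) (fcomp H H)).
Context (HW : weak_entwining T D w) (S : Gamma_splitting T w).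

Local Notation m := (monad_mult T).
Local Notation e := (monad_unit T).
Local Notation d := (comonad_comult D).
Local Notation eps := (comonad_counit D).
Local Notation F f := (fmap H f).
Local Notation G := (split_ob S).
Local Notation p := (split_p S).
Local Notation i := (split_i S).
Local Notation AH := (module_category T).

(* An associative but non-unital action on H a, whose restriction along e
   is Γ. *)
Definition beta (M : module T) :
    hom (H (H (carrier M))) (H (carrier M)) :=
  F (action M) ∘ w (carrier M).

Lemma w_nat (a b : A) (f : hom a b) : w b ∘ F (F f) = F (F f) ∘ w a.
Proof. exact: (naturality w f). Qed.
Lemma m_nat (a b : A) (f : hom a b) : m b ∘ F (F f) = F f ∘ m a.
Proof. exact: (naturality m f). Qed.
Lemma e_nat (a b : A) (f : hom a b) : e b ∘ f = F f ∘ e a.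
Proof. exact: (naturality e f). Qed.
Lemma d_nat (a b : A) (f : hom a b) : d b ∘ F f = F (F f) ∘ d a.
Proof. exact: (naturality d f). Qed.
Lemma eps_nat (a b : A) (f : hom a b) : eps b ∘ F f = f ∘ eps a.
Proof. exact: (naturality eps f). Qed.

Lemma beta_e (M : module T) : beta M ∘ e (H (carrier M)) = Gamma w M.
Proof. by []. Qed.

Lemma beta_assoc (M : module T) :
  beta M ∘ m (H (carrier M)) = beta M ∘ F (beta M).
Proof.
rewrite /beta fmap_comp; assocl; rewrite (post2 (w_nat _)); assocl.
rewrite -fmap_comp -(module_assoc (module_axioms M)) fmap_comp.
by rewrite (post2 (entwining_mult HW _)); assocl.
Qed.

Lemma Gamma_nat (M N : module T) (f : module_hom M N) :
  F f ∘ Gamma w M = Gamma w N ∘ F f.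
Proof.
rewrite /Gamma; assocl; rewrite -fmap_comp module_map_action fmap_comp.
by rewrite (post2 (e_nat _)); assocl; rewrite (post2 (w_nat _)); assocl.
Qed.

Lemma beta_nat (M N : module T) (f : module_hom M N) :
  F f ∘ beta M = beta N ∘ F (F f).
Proof.
rewrite /beta; assocl; rewrite (post2 (w_nat _)); assocl.
by rewrite -!fmap_comp module_map_action.
Qed.

Lemma Gamma_beta (M : module T) : Gamma w M ∘ beta M = beta M.
Proof.
rewrite -(beta_e M) (post2 (e_nat (beta M))); assocl; rewrite -beta_assoc.
by rewrite (post2 (mult_unit_l T _)) comp_idr.
Qed.

Lemma beta_Gamma (M : module T) : beta M ∘ F (Gamma w M) = beta M.
Proof.
rewrite -beta_e fmap_comp; assocl; rewrite -beta_assoc.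
by rewrite (post2 (mult_unit_r T _)) comp_idr.
Qed.

Lemma p_Gamma (M : module T) : p M ∘ Gamma w M = p M.
Proof. by rewrite -(split_ip S); assocl; rewrite split_pi comp_idl. Qed.

Lemma Gamma_i (M : module T) : Gamma w M ∘ i M = i M.
Proof. by rewrite -(split_ip S) (post2 (split_pi S M)) comp_idr. Qed.

Definition G_action (M : module T) : hom (H (G M)) (G M) :=
  p M ∘ F (action M) ∘ w (carrier M) ∘ F (i M).

Lemma G_actionE (M : module T) : G_action M = p M ∘ beta M ∘ F (i M).
Proof. by rewrite /beta; assocl. Qed.

Lemma i_G_action (M : module T) : i M ∘ G_action M = beta M ∘ F (i M).
Proof. by rewrite G_actionE; assocl; rewrite split_ip Gamma_beta. Qed.

Lemma G_action_Fp (M : module T) : G_action M ∘ F (p M) = p M ∘ beta M.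
Proof.
by rewrite G_actionE -comp_assoc -fmap_comp split_ip -comp_assoc beta_Gamma.
Qed.

Lemma G_is_module (M : module T) : is_module T (G_action M).
Proof.
split.
- rewrite {3}G_actionE; fmapl; rewrite G_action_Fp.
  rewrite (post2 (eq_sym (beta_assoc M))); assocl.
  by rewrite (post2 (m_nat (i M))) G_actionE; assocl.
- rewrite G_actionE (post2 (eq_sym (e_nat (i M)))); assocl.
  by rewrite (post2 (beta_e M)) p_Gamma split_pi.
Qed.

Definition G_ob (M : module T) : module T := Module (G_is_module M).

Lemma G_hom_action (M N : module T) (f : module_hom M N) :
  p N ∘ F f ∘ i M ∘ G_action M = G_action N ∘ F (p N ∘ F f ∘ i M).
Proof.
fmapl; rewrite G_action_Fp (post2 (i_G_action M)); assocl.
by rewrite (post2 (beta_nat f)); assocl.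
Qed.

Definition G_hom (M N : module T) (f : module_hom M N) :
    module_hom (G_ob M) (G_ob N) :=
  @ModuleHom A H T (G_ob M) (G_ob N) (p N ∘ F f ∘ i M) (G_hom_action f).

Lemma G_hom_p (M N : module T) (f : module_hom M N) :
  p N ∘ F f ∘ i M ∘ p M = p N ∘ F f.
Proof.
by rewrite (post2 (split_ip S M)) (post2 (Gamma_nat f)); assocl; rewrite p_Gamma.
Qed.

Lemma i_G_hom (M N : module T) (f : module_hom M N) :
  i N ∘ (p N ∘ F f ∘ i M) = F f ∘ i M.
Proof.
by assocl; rewrite split_ip -Gamma_nat (post2 (Gamma_i M)).
Qed.

Definition G_functor : functor AH AH.
Proof.
refine (@Functor AH AH G_ob G_hom _ _).
- move=> M; apply: module_hom_eq => /=.
  by rewrite fmap_id comp_idr split_pi.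
- move=> M N P g f; apply: module_hom_eq => /=.
  by assocl; rewrite G_hom_p fmap_comp; assocl.
Defined.

Definition G_comult_map (M : module T) : hom (G M) (G (G_ob M)) :=
  p (G_ob M) ∘ F (p M) ∘ d (carrier M) ∘ i M.

(* The counit is ε_a ∘ i. It cannot be h ∘ i: for the entwining given by a
   bialgebra Γ is the identity and h is in general not a module morphism from
   the diagonal action; nor would [free_bimodule] satisfy the counit law, since
   m ∘ δ is in general not the identity. *)
Definition G_counit_map (M : module T) : hom (G M) (carrier M) :=
  eps (carrier M) ∘ i M.

(* [p (G_ob M) ∘ F (p M)] and [F (i M) ∘ i (G_ob M)] exhibit G (G M) as a
   retract of H (H M); the idempotent is [Gamma2 M]. *)
Definition Gamma2 (M : module T) :
    hom (H (H (carrier M))) (H (H (carrier M))) :=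
  F (beta M) ∘ w (H (carrier M)) ∘ e (H (H (carrier M))).

Lemma d_beta (M : module T) :
  d (carrier M) ∘ beta M
  = F (beta M) ∘ w (H (carrier M)) ∘ F (d (carrier M)).
Proof.
rewrite /beta; assocl; rewrite d_nat (post2 (entwining_comult HW _)) fmap_comp.
by assocl.
Qed.

Lemma d_Gamma (M : module T) :
  d (carrier M) ∘ Gamma w M = Gamma2 M ∘ d (carrier M).
Proof.
rewrite -beta_e; assocl; rewrite d_beta (post2 (eq_sym (e_nat (d _)))).
by assocl.
Qed.

Lemma Fi_Gamma_Fp (M : module T) :
  F (i M) ∘ Gamma w (G_ob M) ∘ F (p M) = Gamma2 M.
Proof.
rewrite /Gamma; assocl; rewrite -(fmap_comp H (i M) (G_action M)) i_G_action.
rewrite (post2 (e_nat (F (p M)))); assocl.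
rewrite (post2 (w_nat (p M))); assocl.
rewrite fmap_comp (post2 (eq_sym (fmap_comp H (F (i M)) (F (p M))))).
rewrite -(fmap_comp H (i M) (p M)) split_ip -(fmap_comp H (beta M)).
by rewrite beta_Gamma.
Qed.

Lemma iG_comult (M : module T) :
  i (G_ob M) ∘ G_comult_map M = F (p M) ∘ d (carrier M) ∘ i M.
Proof.
rewrite /G_comult_map; assocl; rewrite split_ip.
have -> : Gamma w (G_ob M) ∘ F (p M) = F (p M) ∘ Gamma2 M.
  rewrite -Fi_Gamma_Fp; assocl.
  by rewrite -fmap_comp split_pi fmap_id comp_idl.
by rewrite (post2 (eq_sym (d_Gamma M))); assocl; rewrite (post2 (Gamma_i M)).
Qed.

Lemma G_comult_p (M : module T) :
  G_comult_map M ∘ p M = p (G_ob M) ∘ F (p M) ∘ d (carrier M).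
Proof.
rewrite /G_comult_map (post2 (split_ip S M)) (post2 (d_Gamma M)); assocl.
rewrite -Fi_Gamma_Fp; assocl.
rewrite (post2 (eq_sym (fmap_comp H (p M) (i M)))) split_pi fmap_id comp_idr.
by rewrite p_Gamma.
Qed.

Lemma G_comult_action (M : module T) :
  G_comult_map M ∘ G_action M
  = G_action (G_ob M) ∘ F (G_comult_map M).
Proof.
rewrite {1}G_actionE; assocl; rewrite G_comult_p (post2 (d_beta M)); assocl.
rewrite (post2 (eq_sym (fmap_comp H (p M) (beta M)))) -G_action_Fp.
rewrite (G_actionE (G_ob M)) /beta; assocl.
rewrite (post2 (eq_sym (fmap_comp H (i (G_ob M)) (G_comult_map M)))).
rewrite iG_comult; fmapl.
by rewrite (post2 (w_nat (p M))); assocl.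
Qed.

Definition G_comult_hom (M : module T) :
    module_hom (G_ob M) (G_ob (G_ob M)) :=
  @ModuleHom A H T (G_ob M) (G_ob (G_ob M)) (G_comult_map M)
    (G_comult_action M).

Lemma eps_beta (M : module T) :
  eps (carrier M) ∘ beta M
  = action M ∘ F (eps (carrier M) ∘ Gamma w M).
Proof.
have E : action M ∘ xi T D w (carrier M) = eps (carrier M) ∘ Gamma w M.
  by rewrite /Gamma /xi; assocl; rewrite eps_nat.
rewrite -E /beta; assocl; rewrite eps_nat (post2 (entwining_counit HW _)).
by assocl; rewrite (module_assoc (module_axioms M)); fmapl.
Qed.

Lemma G_counit_action (M : module T) :
  G_counit_map M ∘ G_action M = action M ∘ F (G_counit_map M).
Proof.
rewrite /G_counit_map (post2 (i_G_action M)); assocl; rewrite eps_beta.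
by rewrite (post2 (eq_sym (fmap_comp H _ (i M)))) (post2 (Gamma_i M)).
Qed.

Definition G_counit_hom (M : module T) : module_hom (G_ob M) M :=
  @ModuleHom A H T (G_ob M) M (G_counit_map M) (G_counit_action M).

Lemma Feps_Gamma_d (M : module T) :
  F (eps (carrier M) ∘ Gamma w M) ∘ d (carrier M) = Gamma w M.
Proof.
have E : action M ∘ xi T D w (carrier M) = eps (carrier M) ∘ Gamma w M.
  by rewrite /Gamma /xi; assocl; rewrite eps_nat.
rewrite -E; fmapl; rewrite (post2 (eq_sym (entwining_unit HW _))) /Gamma.
by assocl.
Qed.

Definition G_comult : nat_trans G_functor (fcomp G_functor G_functor).
Proof.
refine (@NatTrans AH AH G_functor (fcomp G_functor G_functor)
  G_comult_hom _).
move=> M N f; apply: module_hom_eq => /=; assocl.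
rewrite G_comult_p (post2 (d_nat f)); assocl.
rewrite (post2 (iG_comult M)); fmapl.
rewrite (post2 (eq_sym (fmap_comp H (i M) (p M)))) split_ip.
rewrite (post2 (eq_sym (fmap_comp H (F f) (Gamma w M)))).
rewrite Gamma_nat fmap_comp; assocl.
by rewrite (post2 (eq_sym (fmap_comp H (p N) (Gamma w N)))) p_Gamma.
Defined.

Definition G_counit : nat_trans G_functor (fid AH).
Proof.
refine (@NatTrans AH AH G_functor (fid AH) G_counit_hom _).
move=> M N f; apply: module_hom_eq => /=.
by rewrite /G_counit_map (post2 (i_G_hom f)); assocl; rewrite eps_nat.
Defined.

Definition G_comonad : comonad G_functor.
Proof.
refine (@Comonad AH G_functor G_comult G_counit _ _ _).
- move=> M; apply: module_hom_eq => /=.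
  rewrite (post2 (iG_comult M)); assocl.
  rewrite (post2 (iG_comult M)); assocl.
  rewrite (post2 (eq_sym (fmap_comp H (G_comult_map M) (p M)))) G_comult_p.
  rewrite (post2 (d_nat (p M))); fmapl.
  by rewrite (post2 (comult_coassoc D _)); assocl.
- move=> M; apply: module_hom_eq => /=.
  rewrite /G_counit_map (post2 (iG_comult M)); assocl.
  rewrite eps_nat (post2 (comult_counit_l D _)) comp_idr.
  exact: split_pi.
- move=> M; apply: module_hom_eq => /=.
  rewrite /G_counit_map (post2 (iG_comult M)); assocl.
  rewrite (post2 (eq_sym (fmap_comp H _ (p M)))) (post2 (split_ip S M)).
  by rewrite (post2 (Feps_Gamma_d M)) p_Gamma split_pi.
Defined.

(** * The comparison functors into G-comodules *)

Local Notation AHG := (comodule_category G_comonad).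
Local Notation "[ 'mod' M ]" := (bimodule_to_module M).

Lemma Gamma_bicoaction (M : bimodule T D w) :
  Gamma w [mod M] ∘ bicoaction M = bicoaction M.
Proof.
rewrite /Gamma (post2 (e_nat (bicoaction M))); assocl.
rewrite -bimodule_mixed (post2 (module_unit (bimodule_module M))).
exact: comp_idr.
Qed.

Definition Phi_coaction_map (M : bimodule T D w) :
    hom (bicarrier M) (G [mod M]) :=
  p [mod M] ∘ bicoaction M.

Lemma Phi_coaction_action (M : bimodule T D w) :
  Phi_coaction_map M ∘ biaction M
  = G_action [mod M] ∘ F (Phi_coaction_map M).
Proof.
rewrite /Phi_coaction_map fmap_comp; assocl; rewrite G_action_Fp.
by rewrite (post2 (bimodule_mixed M)) /beta; assocl.
Qed.

Definition Phi_coaction (M : bimodule T D w) :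
    module_hom [mod M] (G_ob [mod M]) :=
  @ModuleHom A H T [mod M] (G_ob [mod M]) (Phi_coaction_map M)
    (Phi_coaction_action M).

Lemma Phi_is_comodule (M : bimodule T D w) :
  @is_comodule AH G_functor G_comonad [mod M] (Phi_coaction M).
Proof.
split; apply: module_hom_eq => /=.
- rewrite /Phi_coaction_map; assocl; rewrite G_comult_p.
  rewrite (post2 (comodule_coassoc (bimodule_comodule M))); assocl.
  rewrite (post2 (split_ip S _)) (post2 (Gamma_bicoaction M)) fmap_comp.
  by assocl.
- rewrite /G_counit_map /Phi_coaction_map; assocl.
  rewrite (post2 (split_ip S _)) (post2 (Gamma_bicoaction M)).
  exact: (comodule_counit (bimodule_comodule M)).
Qed.

Definition Phi_ob (M : bimodule T D w) : AHG :=
  Comodule (Phi_is_comodule M).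

Definition Phi_module_hom (M N : bimodule T D w) (f : bimodule_hom M N) :
    module_hom [mod M] [mod N] :=
  @ModuleHom A H T [mod M] [mod N] f (bimodule_map_action f).

Lemma Phi_hom_coaction (M N : bimodule T D w) (f : bimodule_hom M N) :
  coaction (Phi_ob N) ∘ (Phi_module_hom f : @hom AH [mod M] [mod N])
  = fmap G_functor (Phi_module_hom f) ∘ coaction (Phi_ob M).
Proof.
apply: module_hom_eq => /=; rewrite /Phi_coaction_map; assocl.
rewrite (post2 (bimodule_map_coaction f)) (post2 (split_ip S _)).
by rewrite (post2 (Gamma_bicoaction M)); assocl.
Qed.

Definition Phi_hom (M N : bimodule T D w) (f : bimodule_hom M N) :
    comodule_hom (Phi_ob M) (Phi_ob N) :=
  @ComoduleHom AH G_functor G_comonad (Phi_ob M) (Phi_ob N)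
    (Phi_module_hom f) (Phi_hom_coaction f).

Definition Phi : functor (bimodule_category T D w) AHG.
Proof.
refine (@Functor (bimodule_category T D w) AHG Phi_ob Phi_hom _ _).
- by move=> M; apply: comodule_hom_eq; apply: module_hom_eq.
- by move=> M N P g f; apply: comodule_hom_eq; apply: module_hom_eq.
Defined.

Definition K (HC : compatible T D w) : functor A AHG := fcomp Phi (K_omega HC).

End InducedComonad.

Arguments K_omega {A H T D w} HC.
Arguments G_comonad {A H T D w} HW S.
Arguments Phi {A H T D w} HW S.
Arguments K {A H T D w} HW S HC.

(* Main.v *)
(** Write [h] and [θ] for the action and coaction of a mixed bimodule [M] on [a].
    Under the bijection [f ↦ f ∘ e], module morphisms from the free module
    [(H x, m)] to [M] correspond to morphisms [t : x → a], and compatibility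
    makes [h ∘ H t] a comodule morphism exactly when [t] equalises [θ] and
    [H h ∘ δ ∘ e].  Hence a universal arrow from [K_ω] to [M] is the same thing
    as an equaliser of that pair.  Universal arrows transfer to [K = Φ K_ω]
    because [Φ] is an equivalence; a [G]-comodule [ρ] comes from the
    [H]-coaction [i ∘ ρ]. *)
Require Import Defs.
From Stdlib Require Import ssreflect ClassicalEpsilon.

Set Implicit Arguments.
Unset Strict Implicit.
Unset Printing Implicit Defensive.

Local Open Scope cat_scope.

(** * Right adjoints as families of universal arrows *)

Definition is_universal_arrow (A B : category) (L : functor A B) (b : B)
    (x : A) (k : hom (L x) b) : Prop :=
  forall (a : A) (f : hom (L a) b), exists! u : hom a x, k ∘ fmap L u = f.

Definition has_universal_arrow (A B : category) (L : functor A B) (b : B) :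
    Prop :=
  exists (x : A) (k : hom (L x) b), is_universal_arrow k.

(** The counit at [b] is universal: the left triangle identity gives existence of the factorisation,
    the right one its uniqueness. *)
Lemma right_adjoint_universal_arrow (A B : category) (L : functor A B) :
  has_right_adjoint L -> forall b, has_universal_arrow L b.
Proof.
case=> R [[u c tl tr]] b; exists (R b), (c b) => a f.
exists (fmap R f ∘ u a); split.
- rewrite fmap_comp; assocl.
  rewrite -[fmap L (fmap R f)]/(fmap (fcomp L R) f) (naturality c f).
  by rewrite (post2 (tl a)) comp_idr.
- move=> v <-; rewrite fmap_comp.
  rewrite (post2 (eq_sym (naturality u v))) comp_assoc.
  by rewrite tr comp_idl.
Qed.

Section AdjunctionFromUniversalArrows.
Context (A B : category) (L : functor A B).
Context (R : B -> A) (k : forall b, hom (L (R b)) b).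
Context (univ : forall b, is_universal_arrow (k b)).

Definition factor (a : A) (b : B) (f : hom (L a) b) : hom a (R b) :=
  proj1_sig (constructive_indefinite_description _ (univ f)).

Lemma factorK (a : A) (b : B) (f : hom (L a) b) :
  k b ∘ fmap L (factor f) = f.
Proof. by rewrite /factor; case: constructive_indefinite_description => u []. Qed.

(** The cancellation behind the functor laws of [right_functor], naturality of the unit and the
    right triangle identity: each is checked after composing with [k]. *)
Lemma universal_arrow_inj (a : A) (b : B) (u v : hom a (R b)) :
  k b ∘ fmap L u = k b ∘ fmap L v -> u = v.
Proof.
move=> E; case: (univ (k b ∘ fmap L v)) => t [_ Ht].
by rewrite -(Ht _ E) -(Ht _ eq_refl).
Qed.

Definition right_functor : functor B A.
Proof.
refine (@Functor B A R (fun b c g => factor (g ∘ k b)) _ _).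
- move=> b; apply: universal_arrow_inj.
  by rewrite factorK fmap_id comp_idl comp_idr.
- move=> b c d g f; apply: universal_arrow_inj.
  rewrite factorK fmap_comp; assocl; rewrite factorK.
  by rewrite (post2 (factorK _)); assocl.
Defined.

Lemma right_functor_adjoint : inhabited (adjunction L right_functor).
Proof.
have unitN (a b : A) (f : hom a b) :
  factor (idm (L b)) ∘ f = fmap right_functor (fmap L f) ∘ factor (idm (L a)).
  apply: universal_arrow_inj; rewrite !fmap_comp; assocl.
  by rewrite !factorK comp_idl (post2 (factorK _)) comp_idr.
have counitN (b c : B) (g : hom b c) :
  k c ∘ fmap L (fmap right_functor g) = g ∘ k b.
  exact: factorK.
constructor.
exists (@NatTrans A A (fid A) (fcomp right_functor L)
          (fun a => factor (idm (L a))) unitN)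
       (@NatTrans B B (fcomp L right_functor) (fid B) k counitN).
- by move=> a; exact: factorK.
- move=> b; apply: universal_arrow_inj => /=.
  by rewrite fmap_comp; assocl; rewrite factorK (post2 (factorK _)) fmap_id.
Qed.

End AdjunctionFromUniversalArrows.

Lemma has_right_adjointE (A B : category) (L : functor A B) :
  has_right_adjoint L <-> forall b, has_universal_arrow L b.
Proof.
split; first exact: right_adjoint_universal_arrow.
move=> U.
(* Universal arrows merely exist at each [b]; choice selects first the object, then the arrow, as
   functions of [b]. *)
pose c b := constructive_indefinite_description _ (U b).
pose d b := constructive_indefinite_description _ (proj2_sig (c b)).
exists (right_functor (fun b => proj2_sig (d b))).
exact: right_functor_adjoint.
Qed.

(** * Transport of universal arrows *)

Lemma universal_arrow_iso (A B : category) (L : functor A B) (b c : B)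
    (f : hom b c) (g : hom c b) :
  f ∘ g = idm c -> g ∘ f = idm b ->
  has_universal_arrow L b -> has_universal_arrow L c.
Proof.
move=> fg gf [x [k U]]; exists x, (f ∘ k) => a t.
case: (U a (g ∘ t)) => u [Eu Hu]; exists u; split.
- by rewrite -comp_assoc Eu comp_assoc fg comp_idl.
- by move=> v Ev; apply: Hu; rewrite -Ev; assocl; rewrite gf comp_idl.
Qed.

Definition fully_faithful (B C : category) (P : functor B C) : Prop :=
  forall (a b : B) (g : hom (P a) (P b)), exists! f : hom a b, fmap P f = g.

(** [P] maps arrows from [L a] to [b] bijectively onto arrows from [P (L a)] to [P b], compatibly
    with precomposition by [L u], so unique factorisations correspond. *)
Lemma universal_arrow_fully_faithful (A B C : category) (P : functor B C)
    (L : functor A B) (b : B) :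
  fully_faithful P ->
  has_universal_arrow (fcomp P L) (P b) <-> has_universal_arrow L b.
Proof.
move=> ff.
have inj (a c : B) (f g : hom a c) : fmap P f = fmap P g -> f = g.
  by case: (ff _ _ (fmap P g)) => t [_ Ht] /Ht <-; rewrite (Ht g).
split=> -[x [k U]].
- case: (ff _ _ k) => k' [Ek _]; exists x, k' => a f.
  case: (U a (fmap P f)) => u [Eu Hu]; exists u; split.
  + by apply: inj; rewrite fmap_comp Ek.
  + by move=> v Ev; apply: Hu; rewrite -Ev fmap_comp Ek.
- exists x, (fmap P k) => a g.
  case: (ff _ _ g) => f [Ef _].
  case: (U a f) => u [Eu Hu]; exists u; split.
  + by rewrite -Ef -Eu fmap_comp.
  + by move=> v Ev; apply: Hu; apply: inj; rewrite Ef -Ev fmap_comp.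
Qed.

(** * Universal arrows from [K_omega] as equalisers *)

Section Entwining.
Context (A : category) (H : functor A A) (T : monad H) (D : comonad H).
Context (w : nat_trans (fcomp H H) (fcomp H H)).
Local Notation e := (monad_unit T).
Local Notation d := (comonad_comult D).
Local Notation F f := (fmap H f).

Definition second_coaction (M : bimodule T D w) :
    hom (bicarrier M) (H (bicarrier M)) :=
  F (biaction M) ∘ d (bicarrier M) ∘ e (bicarrier M).

Section Compatible.
Context (HC : compatible T D w).

Lemma bimodule_hom_transpose (x : A) (M : bimodule T D w)
    (f : bimodule_hom (free_bimodule HC x) M) :
  biaction M ∘ F (f ∘ e x) = f.
Proof.
rewrite fmap_comp comp_assoc -(bimodule_map_action f) /=.
by rewrite (post2 (mult_unit_r T x)) comp_idr.
Qed.

(** As [f] is a comodule morphism, the left side is [F f ∘ d x ∘ e x]. Writing this [f] as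
    [biaction M ∘ F (f ∘ e x)] and moving [f ∘ e x] past [d] and [e] by naturality gives the right
    side. *)
Lemma bimodule_hom_equalises (x : A) (M : bimodule T D w)
    (f : bimodule_hom (free_bimodule HC x) M) :
  bicoaction M ∘ (f ∘ e x) = second_coaction M ∘ (f ∘ e x).
Proof.
rewrite comp_assoc bimodule_map_coaction /= -{1}(bimodule_hom_transpose f).
rewrite (fmap_comp H (biaction M)) /second_coaction (post2 (e_nat T _)); assocl.
by rewrite (post2 (d_nat D _)); assocl.
Qed.

Lemma transpose_coaction (x : A) (M : bimodule T D w) (t : hom x (bicarrier M)) :
  bicoaction M ∘ t = second_coaction M ∘ t ->
  bicoaction M ∘ (biaction M ∘ F t) = F (biaction M ∘ F t) ∘ d x.
Proof.
move=> E; rewrite comp_assoc bimodule_mixed -comp_assoc -fmap_comp E.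
rewrite /second_coaction; fmapl; rewrite (post2 (w_nat w _)); assocl.
rewrite -fmap_comp -(module_assoc (bimodule_module M)) fmap_comp.
rewrite -[RHS]comp_assoc -(d_nat D t) comp_assoc.
(* Compatibility precomposed with [F e], where [m ∘ F e] is the identity, expresses [d] through [w];
   this absorbs the [w] introduced by the mixed law. *)
have Ed : F (monad_mult T _) ∘ w _ ∘ F (d (bicarrier M)) ∘ F (e (bicarrier M))
    = d (bicarrier M).
  by rewrite -HC (post2 (mult_unit_r T _)) comp_idr.
by rewrite -[in RHS]Ed; assocl.
Qed.

Lemma transpose_action (x : A) (M : bimodule T D w) (t : hom x (bicarrier M)) :
  biaction M ∘ F t ∘ monad_mult T x = biaction M ∘ F (biaction M ∘ F t).
Proof.
rewrite (post2 (eq_sym (m_nat T t))); assocl.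
by rewrite (module_assoc (bimodule_module M)); fmapl.
Qed.

Definition transpose (x : A) (M : bimodule T D w) (t : hom x (bicarrier M))
    (E : bicoaction M ∘ t = second_coaction M ∘ t) :
    bimodule_hom (free_bimodule HC x) M :=
  @BimoduleHom A H T D w (free_bimodule HC x) M (biaction M ∘ F t)
    (transpose_action t) (transpose_coaction E).

Lemma action_Fmap_unit (x : A) (M : bimodule T D w) (t : hom x (bicarrier M)) :
  biaction M ∘ F t ∘ e x = t.
Proof.
rewrite (post2 (eq_sym (e_nat T t))); assocl.
by rewrite (module_unit (bimodule_module M)) comp_idl.
Qed.

(** [f ↦ f ∘ e] and [transpose] are mutually inverse, and naturality of [e] turns precomposition
    with [F u] into precomposition with [u]. *)
Lemma universal_arrow_equaliser (M : bimodule T D w) :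
  has_universal_arrow (K_omega HC) M <->
  has_equaliser (bicoaction M) (second_coaction M).
Proof.
split.
- move=> [x [k U]]; exists x, (bimodule_map k ∘ e x); split.
    exact: bimodule_hom_equalises.
  move=> y t E; case: (U y (transpose E)) => u [Eu Hu]; exists u; split.
  + rewrite -comp_assoc (e_nat T u) comp_assoc.
    move: (f_equal (fun f : bimodule_hom _ _ => bimodule_map f) Eu) => /= ->.
    exact: action_Fmap_unit.
  + move=> v Ev; apply: Hu; apply: bimodule_hom_eq => /=.
    rewrite -Ev -comp_assoc (e_nat T v) comp_assoc; apply: eq_sym.
    exact: (bimodule_hom_transpose (bimodule_comp k (free_bimodule_map HC v))).
- move=> [x [k [E U]]]; exists x, (transpose E) => a f.
  case: (U a _ (bimodule_hom_equalises f)) => u [Eu Hu]; exists u; split.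
  + apply: bimodule_hom_eq => /=.
    by rewrite -comp_assoc -fmap_comp Eu bimodule_hom_transpose.
  + move=> v Ev; apply: Hu; rewrite -Ev /= -comp_assoc -(e_nat T v) comp_assoc.
    by rewrite action_Fmap_unit.
Qed.

End Compatible.

(** * [Phi] as an equivalence *)

Section Comparison.
Context (HW : weak_entwining T D w) (S : Gamma_splitting T w).
Local Notation p := (split_p S).
Local Notation i := (split_i S).
Local Notation AHG := (comodule_category (G_comonad HW S)).

Lemma Phi_fully_faithful : fully_faithful (Phi HW S).
Proof.
move=> M N g.
pose g0 : hom (bicarrier M) (bicarrier N) := module_map (comodule_map g).
have Ha : g0 ∘ biaction M = biaction N ∘ F g0.
  exact: (module_map_action (comodule_map g)).
have Hc : bicoaction N ∘ g0 = F g0 ∘ bicoaction M.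
  have /= := f_equal (fun f : module_hom _ _ => module_map f)
    (comodule_map_coaction g).
  rewrite /Phi_coaction_map -/g0 => E.
  (* Composing with [i] turns [i ∘ p] into Γ, which fixes bimodule coactions and commutes with
     [F g0], so the projections disappear. *)
  have {}E := f_equal (fun f => i _ ∘ f) E; move: E; assocl.
  rewrite !split_ip Gamma_bicoaction (post2 (split_ip S _)).
  rewrite (post2 (Gamma_bicoaction _)) => ->.
  by rewrite -(Gamma_nat w (comodule_map g)) (post2 (Gamma_bicoaction _)).
exists (BimoduleHom Ha Hc); split.
- by apply: comodule_hom_eq; apply: module_hom_eq.
- by move=> f Ef; apply: bimodule_hom_eq; rewrite /= /g0 -Ef.
Qed.

Section Inverse.
Context (N : AHG).
Let M : module T := cocarrier N.
Let r : module_hom M (G_ob HW S M) := coaction N.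

Definition G_comodule_coaction : hom (carrier M) (H (carrier M)) := i M ∘ r.

(** [i] is fixed by Γ, and [d] carries Γ to [Gamma2], whose leading factor [F (beta M)] is fixed by
    [F (Gamma w M)]. *)
Lemma FGamma_d_i : F (Gamma w M) ∘ d (carrier M) ∘ i M = d (carrier M) ∘ i M.
Proof.
rewrite -[in RHS](Gamma_i S M) -{1}(Gamma_i S M); assocl.
rewrite (post2 (d_Gamma HW M)) (d_Gamma HW M) /Gamma2; assocl.
by rewrite -fmap_comp (Gamma_beta HW).
Qed.

Lemma G_comodule_is_comodule : is_comodule D G_comodule_coaction.
Proof.
case: (comodule_axioms N) => Hco Hcu; split; rewrite /G_comodule_coaction.
- have /= E := f_equal (fun f : module_hom _ _ => module_map f) Hco.
  (* This embeds [G (G M)] into [H (H M)]: the comultiplication of the induced comonad becomes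
     [d ∘ i], and its functor applied to [r] becomes [F (i M ∘ r) ∘ i M]. *)
  have {}E := f_equal (fun f => F (i M) ∘ (i (G_ob HW S M) ∘ f)) E.
  move: E; rewrite -/M -/r; assocl.
  rewrite (post2 (iG_comult HW S M)); assocl.
  rewrite -fmap_comp split_ip FGamma_d_i (post2 (split_ip S _)).
  rewrite (post2 (eq_sym (Gamma_nat w r))); assocl.
  by rewrite (post2 (Gamma_i S M)) fmap_comp => ->.
- have /= E := f_equal (fun f : module_hom _ _ => module_map f) Hcu.
  by rewrite comp_assoc; exact: E.
Qed.

(** [i] intertwines [G_action] with [beta], so the mixed law is the module-map law of [r] composed
    with [i]. *)
Lemma G_comodule_mixed :
  G_comodule_coaction ∘ action M
  = F (action M) ∘ w (carrier M) ∘ F G_comodule_coaction.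
Proof.
rewrite /G_comodule_coaction (post2 (module_map_action r)) /=.
by rewrite comp_assoc (i_G_action HW) /beta; fmapl.
Qed.

Definition G_comodule_bimodule : bimodule T D w :=
  Bimodule (module_axioms M) G_comodule_is_comodule G_comodule_mixed.

End Inverse.

Lemma Phi_essentially_surjective (N : AHG) :
  exists (M : bimodule T D w) (f : hom (Phi HW S M) N) (g : hom N (Phi HW S M)),
    f ∘ g = idm N /\ g ∘ f = idm (Phi HW S M).
Proof.
(* Records have no eta rule here: [bimodule_to_module M] is convertible to the
   original module only once that module is destructed. *)
case: N => [[a h ax] r rax]; pose N : AHG := Comodule rax.
pose M := G_comodule_bimodule N; exists M.
(* Since [p ∘ i] is the identity, the original coaction returns, and the identity of the carrier is
   a comodule map both ways. *)
have E : Phi_coaction_map S M = module_map r.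
  by rewrite /Phi_coaction_map /= /G_comodule_coaction comp_assoc split_pi comp_idl.
pose u : hom (cocarrier (Phi HW S M)) (cocarrier N) := idm (cocarrier N).
pose v : hom (cocarrier N) (cocarrier (Phi HW S M)) := idm (cocarrier N).
have Hu : coaction N ∘ u = fmap (G_functor HW S) u ∘ coaction (Phi HW S M).
  rewrite /u fmap_id comp_idl comp_idr.
  by apply: module_hom_eq; rewrite /= E.
have Hv : coaction (Phi HW S M) ∘ v = fmap (G_functor HW S) v ∘ coaction N.
  rewrite /v fmap_id comp_idl comp_idr.
  by apply: module_hom_eq; rewrite /= E.
exists (@ComoduleHom _ _ _ (Phi HW S M) N u Hu).
exists (@ComoduleHom _ _ _ N (Phi HW S M) v Hv).
by split; apply: comodule_hom_eq; apply: comp_idl.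
Qed.

End Comparison.
End Entwining.

Theorem proposition5p10 (A : category) (H : functor A A)
  (T : monad H) (D : comonad H)
  (w : nat_trans (fcomp H H) (fcomp H H))
  (HW : weak_entwining T D w) (HC : compatible T D w)
  (S : Gamma_splitting T w) :
  (has_right_adjoint (K HW S HC) <->
   forall M : bimodule T D w,
     has_equaliser (bicoaction M)
       (fmap H (biaction M) ∘ comonad_comult D (bicarrier M)
          ∘ monad_unit T (bicarrier M))) /\
  (has_right_adjoint (K_omega HC) <->
   forall M : bimodule T D w,
     has_equaliser (bicoaction M)
       (fmap H (biaction M) ∘ comonad_comult D (bicarrier M)
          ∘ monad_unit T (bicarrier M))).
Proof.
have PhiE (M : bimodule T D w) :=
  universal_arrow_fully_faithful (K_omega HC) M (@Phi_fully_faithful _ _ _ _ _ HW S).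
split; rewrite has_right_adjointE; split=> U M.
- by apply/universal_arrow_equaliser/PhiE; apply: U.
(* A comodule of the induced comonad is replaced by an isomorphic one in the image of [Phi]. *)
- case: (Phi_essentially_surjective M) => N [f [g [fg gf]]].
  by apply: (universal_arrow_iso fg gf); apply/PhiE/universal_arrow_equaliser; apply: U.
- by apply/universal_arrow_equaliser; apply: U.
- by apply/universal_arrow_equaliser; apply: U.
Qed.
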